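(* Let $\mathbb{F}$ be a field and let $A=A_0\oplus A_1$ be a finite dimensional associative superalgebra over $\mathbb{F}$. If $A$ is graded-nil, then $A$ is nilpotent.
   Context: An associative superalgebra over $\mathbb{F}$ is an associative (not necessarily unital) $\mathbb{F}$-algebra $A$ with a vector space decomposition $A=A_0\oplus A_1$ such that $A_iA_j\subseteq A_{i+j \bmod 2}$. Elements of $A_0\cup A_1$ are called homogeneous. $A$ is graded-nil if every homogeneous element of $A$ is nilpotent. $A$ is nilpotent if there is a positive integer $n$ such that every product of $n$ elements of $A$ is zero. *)

(* Defs.v *)
From HB Require Import structures.
From mathcomp Require Import all_boot all_order all_algebra.
Set Implicit Arguments.
Unset Strict Implicit.
Unset Printing Implicit Defensive.
Import GRing.Theory.
Local Open Scope ring_scope.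

(* Finite dimensionality is carried by vectType.  The multiplication is a bare
   bilinear map since the algebra structures of MathComp all have a unit. *)
Record fdSuperalgebra (F : fieldType) := FDSuperalgebra {
  sacarrier :> vectType F;
  samul : {bilinear sacarrier -> sacarrier -> sacarrier};
  sagrade : 'Z_2 -> {vspace sacarrier};
  samulA : associative samul;
  sagrade_sum : (sagrade 0%R + sagrade 1%R)%VS = fullv;
  sagrade_direct : directv (sagrade 0%R + sagrade 1%R);
  samul_grade : forall (i j : 'Z_2) (x y : sacarrier),
        x \in sagrade i -> y \in sagrade j -> samul x y \in sagrade (i + j)%R
}.

Section Superalgebra.
Variables (F : fieldType) (A : fdSuperalgebra F).

Definition homogeneous (x : A) : bool :=
  (x \in sagrade A 0) || (x \in sagrade A 1).

(* (... (x1 * x2) * ...) * xn for s = [:: x1; ...; xn].  There is no empty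
   product without a unit: the value 0 at [::] is a dummy, and every use below
   requires a positive length. *)
Definition saprod (s : seq A) : A :=
  if s is x :: s' then foldl (samul A) x s' else 0.

Definition nilpotent_elt (x : A) : Prop :=
  exists2 n : nat, (0 < n)%N & saprod (nseq n x) = 0.

Definition graded_nil : Prop :=
  forall x : A, homogeneous x -> nilpotent_elt x.

Definition nilpotent_alg : Prop :=
  exists2 n : nat, (0 < n)%N & forall s : n.-tuple A, saprod s = 0.

End Superalgebra.

(* Main.v *)
(** A subspace M spanned by homogeneous elements and stable under left
    multiplication is killed by some power of A, by induction on dim M. For a
    homogeneous x in M, the subspace Ax is again of this kind. If Ax is smaller
    than M, induction applies to it. Otherwise x = ex for some e in A, and
    comparing degrees x = e0 x with e0 the even part of e, so that
    x = e0^n x = 0 by nilpotency of e0. *)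
Require Import Defs.
From mathcomp Require Import all_boot all_order all_algebra.

Set Implicit Arguments.
Unset Strict Implicit.
Unset Printing Implicit Defensive.
Import GRing.Theory.
Local Open Scope ring_scope.

Section GradedNil.
Variables (F : fieldType) (A : fdSuperalgebra F).
Implicit Types (a b e x : A) (s X : seq A).

Definition hbasis : seq A := vbasis (sagrade A 0) ++ vbasis (sagrade A 1).

Lemma span_hbasis : <<hbasis>>%VS = fullv.
Proof. by rewrite span_cat !(span_basis (vbasisP _)) sagrade_sum. Qed.

Lemma homogeneous_hbasis x : x \in hbasis -> homogeneous x.
Proof.
by rewrite mem_cat => /orP[] /vbasis_mem xA; rewrite /homogeneous xA ?orbT.
Qed.

Lemma homogeneousP x :
  reflect (exists i, x \in sagrade A i) (homogeneous x).
Proof.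
apply: (iffP orP) => [[] xA | [[[|[|//]] lti] xA]]; first by exists 0.
- by exists 1.
- by left; congr (x \in sagrade A _): xA; apply/val_inj.
- by right; congr (x \in sagrade A _): xA; apply/val_inj.
Qed.

Lemma homogeneous_mul a b :
  homogeneous a -> homogeneous b -> homogeneous (samul A a b).
Proof.
move=> /homogeneousP[i aA] /homogeneousP[j bA]; apply/homogeneousP.
by exists (i + j); apply: samul_grade.
Qed.

(** By associativity a left-nested product acts on [x] as successive left multiplications, the form
    that suits stable subspaces. *)
Lemma samul_foldl a s x :
  samul A (foldl (samul A) a s) x = samul A a (foldr (samul A) x s).
Proof. by elim: s a => //= b s IHs a; rewrite IHs -samulA. Qed.

(** As a linear map, this action has a subspace as kernel, so its vanishing can be tested on
    generators. *)
Lemma foldr_samul_lfun s :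
  exists f : 'End(A), forall x, f x = foldr (samul A) x s.
Proof.
elim: s => [|a s [f fE]]; first by exists \1%VF => x; rewrite id_lfunE.
by exists (linfun (samul A a) \o f)%VF => x; rewrite comp_lfunE lfunE /= fE.
Qed.

Lemma foldr_samul0 s : foldr (samul A) 0 s = 0.
Proof. by have [f <-] := foldr_samul_lfun s; rewrite linear0. Qed.

Lemma foldr_samul_span X s :
    {in X, forall x, foldr (samul A) x s = 0} ->
  {in <<X>>%VS, forall x, foldr (samul A) x s = 0}.
Proof.
have [f fE] := foldr_samul_lfun s => X0.
have /subvP sXk : (<<X>> <= lker f)%VS.
  by apply/span_subvP => x xX; rewrite memv_ker fE X0.
by move=> x /sXk; rewrite memv_ker fE => /eqP.
Qed.

Lemma nilpotent_elt_fixed e x : nilpotent_elt e -> samul A e x = x -> x = 0.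
Proof.
case=> -[//|n] _ /= en0 ex.
(* The [foldl] is the power of [e] with exponent n + 1, which [en0] makes zero. *)
have : samul A (foldl (samul A) e (nseq n e)) x = x.
  by rewrite samul_foldl; elim: n {en0} => //= n IHn; rewrite IHn.
by rewrite en0 linear0l.
Qed.

Lemma sagrade_disjoint (i : 'Z_2) x :
  x \in sagrade A i -> x \in sagrade A (i + 1) -> x = 0.
Proof.
move=> xi xi1; apply/eqP; rewrite -memv0.
rewrite -(directv_addP (sagrade_direct A)) memv_cap.
by case: i xi xi1 => [[|[|//]] lti] xi xi1; apply/andP; split;
   [move: xi | move: xi1 | move: xi1 | move: xi];
   congr (x \in sagrade A _); apply/val_inj.
Qed.

Lemma graded_nil_fixed e x :
  graded_nil A -> homogeneous x -> samul A e x = x -> x = 0.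
Proof.
move=> nilA /homogeneousP[i xi] ex.
have : e \in fullv by apply: memvf.
rewrite -(sagrade_sum A) => /memv_addP[e0 e0A [e1 e1A def_e]].
apply: (@nilpotent_elt_fixed e0); first by apply: nilA; rewrite /homogeneous e0A.
have e1x : x - samul A e0 x = samul A e1 x.
  by rewrite -{1}ex def_e linearDl addrC addKr.
(* The difference x - e0 x has degree i and, being e1 x, also degree i + 1. *)
apply/esym/eqP; rewrite -subr_eq0; apply/eqP/(@sagrade_disjoint i).
  by rewrite memvB //; have := samul_grade e0A xi; rewrite add0r.
by rewrite e1x addrC; apply: samul_grade.
Qed.

(** A finite list of homogeneous generators stands for the subspace, so that bounds found for single
    generators have a maximum. *)
Lemma graded_nil_kills X :
    graded_nil A -> {in X, forall x, homogeneous x} ->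
    (forall a, {in X, forall x, samul A a x \in <<X>>%VS}) ->
  exists k, forall s, (k <= size s)%N ->
    {in X, forall x, foldr (samul A) x s = 0}.
Proof.
move=> nilA; have [n] := ubnP (\dim <<X>>).
elim: n X => // n IHn X ltXn homX stabX.
have kill1 x : x \in X ->
  exists k, forall s, (k <= size s)%N -> foldr (samul A) x s = 0.
  move=> xX; pose f : 'End(A) := linfun (applyr (samul A) x).
  have fE a : f a = samul A a x by rewrite lfunE.
  (* [Y] generates Ax, and its entries are homogeneous because those of [hbasis] are. *)
  pose Y := [seq f b | b <- hbasis].
  have defY : <<Y>>%VS = limg f by rewrite -limg_span span_hbasis.
  have memY a : samul A a x \in <<Y>>%VS.
    by rewrite defY -fE memv_img ?memvf.
  have sYX : (<<Y>> <= <<X>>)%VS.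
    by apply/span_subvP => _ /mapP[b _ ->]; rewrite fE stabX.
  have [YX | ltYX] := boolP (<<X>> <= <<Y>>)%VS.
    have : x \in <<Y>>%VS by apply: (subvP YX); apply: memv_span.
    rewrite defY => /memv_imgP[e _]; rewrite fE => /esym ex.
    exists 0%N => s _.
    by rewrite (graded_nil_fixed nilA (homX _ xX) ex) foldr_samul0.
  have [||b y|k kP] := IHn Y.
  - by rewrite (leq_trans _ (ltXn : (_ <= n)%N)) //
      ltn_neqAle !(dimv_leqif_sup sYX) ltYX.
  - move=> _ /mapP[b bB ->]; rewrite fE.
    by apply: homogeneous_mul; [apply: homogeneous_hbasis | apply: homX].
  - by case/mapP=> c _ ->; rewrite fE samulA.
  (* The last factor [a] acts first and moves [x] into Ax, which the other factors, at least [k] of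
     them, kill. *)
  exists k.+1; case/lastP=> [//|s a]; rewrite size_rcons ltnS => /kP sY0.
  by rewrite foldr_rcons (foldr_samul_span sY0).
elim: {ltXn homX stabX} X kill1 => [|x X IHX] kill1; first by exists 0%N.
have [k kP] := kill1 x (mem_head x X).
have [|m mP] := IHX; first by move=> y yX; apply: kill1; rewrite inE yX orbT.
exists (maxn k m) => s; rewrite geq_max => /andP[/kP sx /mP sX] y.
by rewrite inE => /predU1P[-> | /sX].
Qed.

End GradedNil.

Theorem corollary3p7 (F : fieldType) (A : fdSuperalgebra F) :
  graded_nil A -> nilpotent_alg A.
Proof.
move=> nilA; have [|k kP] := graded_nil_kills nilA (@homogeneous_hbasis F A).
  by move=> a x _; rewrite span_hbasis memvf.
(* The last factor serves as the vector, the [k] middle ones kill it, and the first one starts the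
   [foldl]. *)
exists k.+2 => // -[[//|a s] /= /eqP[]].
case/lastP: s => [//|s x]; rewrite size_rcons => -[sz_s].
rewrite foldl_rcons samul_foldl (foldr_samul_span (kP s _)) ?linear0r //.
  by rewrite sz_s.
by rewrite span_hbasis memvf.
Qed.
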